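(* Let $d\ge 1$ be an integer and let $\mathcal{C}$ be a cuboid over ground set $E=\{i,\bar{i}:i=1,\ldots,d\}$. Then $\mathcal{C}$ is MFMC if, and only if, $\tau(\mathcal{C},w)=\nu(\mathcal{C},w)$ for all $w\in \mathbb{Z}_{\geq 0}^{E}$ satisfying $w_{i}+w_{\bar{i}} = \tau(\mathcal{C},w)$ for all $i\in \{1,\ldots,d\}$ and $$\tau(\mathcal{C},w)\leq \max\left\{\lfloor 6(d+1)/7 \rfloor,\ \left\lfloor \left(1-1/\sqrt{2d}\right)(d+1)\right\rfloor\right\}.$$
   Context: A clutter $\mathcal{C}$ over a finite ground set $E$ is a family of subsets of $E$, none of which is contained in another. A cuboid over the ground set $E=\{i,\bar i: i=1,\ldots,d\}$ (a set of $2d$ distinct elements) is a clutter $\mathcal{C}$ over $E$ such that $|C\cap\{i,\bar i\}|=1$ for all $C\in\mathcal{C}$ and all $i\in\{1,\ldots,d\}$. A cover of $\mathcal{C}$ is a subset of $E$ that intersects every member of $\mathcal{C}$. For $w\in \mathbb{Z}^E_{\ge 0}$, $\tau(\mathcal{C},w)$ is the minimum of $\sum_{e\in B}w_e$ over all covers $B$ of $\mathcal{C}$, and $\nu(\mathcal{C},w)$ is the maximum of $\sum_{C\in\mathcal{C}}y_C$ over all $y\in\mathbb{Z}^{\mathcal{C}}_{\ge 0}$ with $\sum_{C\ni e}y_C\le w_e$ for all $e\in E$. $\mathcal{C}$ is MFMC if $\tau(\mathcal{C},w)=\nu(\mathcal{C},w)$ for all $w\in \mathbb{Z}^E_{\geq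 0}$. *)

(* Defs.v *)
From mathcomp Require Import boolp classical_sets reals.
From mathcomp Require Import all_boot all_order all_algebra.

Set Implicit Arguments.
Unset Strict Implicit.
Unset Printing Implicit Defensive.

Section Clutters.
Variable E : finType.
Implicit Types (C : {set {set E}}) (B : {set E}) (w : E -> nat).

Definition clutter C : Prop :=
  forall A B, A \in C -> B \in C -> A \subset B -> A = B.

Definition is_cover C B : bool := [forall A in C, A :&: B != set0].

Definition weight w B : nat := \sum_(e in B) w e.

(* A cover exists iff [set0 \notin C]; the seed [[set: E]] of the minimum is
   then itself a cover (see [tauP]). *)
Definition tau C w : nat :=
  weight w [arg min_(B < [set: E] | is_cover C B) weight w B].

(* Only the values of [y] on the members of [C] matter. *)
Definition packing C w (y : {set E} -> nat) : Prop :=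
  forall e, \sum_(A in C | e \in A) y A <= w e.

Definition packing_value C (y : {set E} -> nat) : nat := \sum_(A in C) y A.

Definition max_packing_value C w (k : nat) : Prop :=
  (exists2 y, packing C w y & packing_value C y = k) /\
  (forall y, packing C w y -> packing_value C y <= k).

(* The maximum exists whenever [set0 \notin C] (see [nuP]). *)
Definition nu C w : nat := xget 0 [set k | max_packing_value C w k]%classic.

Definition MFMC C : Prop := forall w, tau C w = nu C w.

Lemma setT_cover C : set0 \notin C -> is_cover C [set: E].
Proof.
move=> C0; apply/forall_inP => A AC; rewrite setIT.
by apply: contra C0 => /eqP <-.
Qed.

Lemma tauP C w : set0 \notin C ->
  (exists2 B, is_cover C B & weight w B = tau C w) /\
  (forall B, is_cover C B -> tau C w <= weight w B).
Proof.
rewrite /tau => /setT_cover CT.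
by case: arg_minnP => // B coverB minB; split => //; exists B.
Qed.

Lemma nuP C w : set0 \notin C -> max_packing_value C w (nu C w).
Proof.
move=> C0.
pose P k := `[< exists2 y, packing C w y & packing_value C y = k >].
have exP : exists k, P k.
  exists (packing_value C (fun=> 0)); apply/asboolP; exists (fun=> 0) => // e.
  by rewrite big1.
have ubP k : P k -> k <= \sum_e w e.
  move=> /asboolP[y yw <-]; rewrite /packing_value.
  apply: (@leq_trans (\sum_e \sum_(A in C | e \in A) y A)); last first.
    by apply: leq_sum => e _; exact: yw.
  rewrite (exchange_big_dep (mem C)) /=; last by move=> e A _ /andP[].
  apply: leq_sum => A AC.
  have /set0Pn[e eA] : A != set0 by apply: contra C0 => /eqP <-.
  by rewrite (bigD1 e) /= ?AC ?eA // leq_addr.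
rewrite /nu; case: xgetP => [k -> //|noP].
case: (ex_maxnP exP ubP) => k /asboolP Pk maxk.
case: (noP k); split=> // y yw; apply: maxk; apply/asboolP.
by exists y.
Qed.

End Clutters.

(* The 2d-element ground set: [(i, false)] is the element i and [(i, true)]
   is its mate \bar i. *)
Definition ground (d : nat) : finType := ('I_d * bool)%type.

Definition elt (d : nat) (i : 'I_d) : ground d := (i, false).
Definition bar (d : nat) (i : 'I_d) : ground d := (i, true).

Definition cuboid (d : nat) (C : {set {set ground d}}) : Prop :=
  clutter C /\
  forall A, A \in C -> forall i : 'I_d, #|A :&: [set elt i; bar i]| = 1.

Lemma cuboid_set0 (d : nat) (C : {set {set ground d}}) :
  0 < d -> cuboid C -> set0 \notin C.
Proof.
move=> d0 [_ cC]; apply/negP => /cC /(_ (Ordinal d0)).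
by rewrite set0I cards0.
Qed.

Import GRing.Theory Num.Theory.
Local Open Scope ring_scope.

Definition tau_bound (R : realType) (d : nat) : int :=
  Num.max (Num.floor (6 * (d%:R + 1) / 7 : R))
          (Num.floor ((1 - 1 / Num.sqrt (2 * d%:R)) * (d%:R + 1) : R)).

(* Main.v *)
Require Import Defs.
From mathcomp Require Import boolp classical_sets reals.
From mathcomp Require Import all_boot all_order all_algebra.
From mathcomp Require Import zify ring lra.

(** Write [D = d + 1] and [T = tau_bound R d]. Only the direction from bounded
    weights to [MFMC] has content, and weak duality reduces [tau = nu] to the
    existence of an integral packing of value [tau].

    Tight weights suffice: a weight [w] that is minimal subject to
    [h <= tau C w] satisfies [w_e + w_(mate e) = h] on every pair
    ([tight_reduction]). If some pair weighed more than [h], each of its two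
    elements would lie in a cover of weight [h]; removing from these two covers
    the element of the pair that each contains, their union is still a cover,
    because a member of a cuboid avoids one element of the pair, and it is
    lighter than [h].

    Packings of tight weights are then built by induction on [tau]. Let [w] be
    tight with [tau C w = tau > T]. Linear programming duality gives either a
    fractional cover of weight below [tau], or a fractional packing of [w] of
    value [tau]; by tightness the latter exhausts [w].

    The first alternative contradicts the hypothesis ([nonideal_witness]). The
    fractional cover may be taken to be a vertex [p] of the covering polyhedron,
    and some [p_e] is not an integer, for otherwise the support of [p] would be
    too light a cover. On the support of [p], the unit vector of [e] is a linear
    combination of members [A] with [p(A) = 1]. Its coefficients sum to [p_e],
    so their fractional parts [c_A] have a non-integral sum [sigma], while the
    vector [sum_A c_A A] is integral on the support of [p]. At most [D] of the
    [c_A] need be nonzero, and replacing each [c_A] by the fractional part of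
    [- c_A] if necessary gives [2 sigma <= D]. Rounding up [sum_A c_A A] yields
    a weight whose [tau] is at least the ceiling of [sigma] but which has no
    packing of more than [sigma]. Lowered to a tight weight whose [tau] is that
    ceiling, it is a weight that does not pack with [tau] at most [(D + 1) / 2],
    which is below [6 D / 7].

    In the second alternative [w = sum_A c_A A] with [sum_A c_A = tau] and at
    most [D] nonzero [c_A]. If some [w - A] with [c_A > 0] keeps
    [tau >= tau - 1], induction applies to it. Otherwise each such [A] comes
    with a cover [B_A] for which [w(B_A) - |A :&: B_A| <= tau - 2]. As every
    member meets [B_A], this forces the trace [Q_A = A :&: B_A] to be large, with
    [(1 - c_A) (|Q_A| - 1) >= 1], and also light, with
    [w(Q_A) <= tau + |Q_A| - 2]. The numbers [1 - c_A] sum to at most [D - tau],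
    so the traces are large on average; taken with multiplicities [c_A] they
    cover each element [e] at most [w_e] times, so by Cauchy-Schwarz over the
    [2 d] elements they cannot all be light. The two estimates are incompatible
    as soon as [(D - tau)^2 < D^2 / (2 d)] ([trace_count]), which is
    [tau > (1 - 1 / sqrt (2 d)) D]. *)

Set Implicit Arguments.
Unset Strict Implicit.
Unset Printing Implicit Defensive.

Import Order.TTheory GRing.Theory Num.Theory.

(** * Packings, covers and tight weights *)

Definition packed (E : finType) (C : {set {set E}}) (w : E -> nat) (k : nat) :=
  exists2 y, packing C w y & packing_value C y = k.

Lemma packing_value_le_weight (E : finType) (C : {set {set E}}) w y B :
  packing C w y -> is_cover C B -> packing_value C y <= weight w B.
Proof.
move=> yw /forall_inP coverB; rewrite /weight.
apply: (@leq_trans (\sum_(e in B) \sum_(A in C | e \in A) y A)); last first.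
  by apply: leq_sum => e _; exact: yw.
rewrite (exchange_big_dep (mem C)) /=; last by move=> e A _ /andP[].
apply: leq_sum => A AC; have /set0Pn[e] := coverB A AC.
by rewrite inE => /andP[eA eB]; rewrite (bigD1 e) /= ?eB ?AC ?eA // leq_addr.
Qed.

Lemma leq_tau (E : finType) (C : {set {set E}}) w h : set0 \notin C ->
  (forall B, is_cover C B -> h <= weight w B) -> h <= tau C w.
Proof. by move=> /(tauP w)[[B coverB <-] _]; apply. Qed.

Lemma tau_eq_nuP (E : finType) (C : {set {set E}}) w : set0 \notin C ->
  tau C w = nu C w <-> packed C w (tau C w).
Proof.
move=> C0; have [nuw max_nu] := nuP w C0.
have [[B coverB wB] _] := tauP w C0.
split=> [->//|[y yw yt]]; apply/eqP; rewrite eqn_leq -{1}yt max_nu //=.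
have [y' yw' <-] := nuw; rewrite -wB; exact: packing_value_le_weight.
Qed.

Lemma packed_le (E : finType) (C : {set {set E}}) w w' k :
  (forall e, w' e <= w e) -> packed C w' k -> packed C w k.
Proof. by move=> le_w [y yw yk]; exists y => // e; apply: leq_trans (le_w e). Qed.

(** The extension step of the induction: a packing of [w - A] together with one
    more copy of [A]. *)
Lemma packedS (E : finType) (C : {set {set E}}) w A k :
    A \in C -> (forall e, e \in A -> 0 < w e) ->
  packed C (fun e => w e - (e \in A)) k -> packed C w k.+1.
Proof.
move=> AC wA [y yw yk].
have addA (P : pred {set E}) :
    \sum_(B in C | P B) (y B + (B == A)) = \sum_(B in C | P B) y B + P A.
  rewrite big_split /=; congr (_ + _); have [PA|PA] := boolP (P A).
    rewrite (bigD1 A) ?AC //= eqxx big1 ?addn0 // => B /andP[_ /negPf->] //.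
  by rewrite big1 // => B /andP[_ PB]; case: eqP PB PA => // -> ->.
exists (fun B => y B + (B == A)) => [e|].
  have := yw e; rewrite addA; case: (boolP (e \in A)) => [/wA|]; lia.
rewrite /packing_value -yk; under eq_bigl do rewrite -[_ \in C]andbT.
by rewrite (addA predT) addn1; congr _.+1; apply: eq_bigl => B; rewrite andbT.
Qed.

Lemma weight_sub (E : finType) (w : E -> nat) (A B : {set E}) :
    (forall e, e \in A -> 0 < w e) ->
  weight (fun e => w e - (e \in A)) B + #|A :&: B| = weight w B.
Proof.
move=> wA; rewrite /weight setIC -sum1_card.
under [X in _ + X]eq_bigl do rewrite inE.
rewrite big_mkcondr /= -big_split /=; apply: eq_bigr => e _.
by case: (boolP (e \in A)) => [/wA|]; lia.
Qed.

Definition mate (d : nat) (e : ground d) : ground d := (e.1, ~~ e.2).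

Lemma mate_neq d (e : ground d) : (mate e == e) = false.
Proof. by case: e => i [] /=; rewrite /mate xpair_eqE /= eqxx. Qed.

Lemma mate_pair d (e : ground d) : [set e; mate e] = [set elt e.1; bar e.1].
Proof. by case: e => i [] //=; rewrite /mate /= setUC. Qed.

Lemma in_mate d (C : {set {set ground d}}) A e :
  cuboid C -> A \in C -> (mate e \in A) = (e \notin A).
Proof.
move=> [_ hC] AC; have := hC A AC e.1; rewrite -mate_pair.
rewrite setIUr cardsU setIACA setIid.
have -> : [set e] :&: [set mate e] = set0.
  by apply/setP => x; rewrite !inE; case: eqP => //= ->; rewrite eq_sym mate_neq.
rewrite setI0 cards0 subn0.
have card1 x : #|A :&: [set x]| = (x \in A).
  by rewrite setIC -sum1_card; under eq_bigl do rewrite 2!inE;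
     rewrite big_mkcondr big_pred1_eq; case: ifP.
by rewrite !card1; case: (e \in A); case: (mate e \in A).
Qed.

Lemma cover_pair d (C : {set {set ground d}}) e :
  cuboid C -> is_cover C [set e; mate e].
Proof.
move=> hC; apply/forall_inP => A AC; apply/set0Pn.
have := in_mate e hC AC; case: (boolP (e \in A)) => [eA _|_ /= mA].
  by exists e; rewrite !inE eqxx eA.
by exists (mate e); rewrite !inE eqxx mA orbT.
Qed.

Lemma weight_pair d w (e : ground d) : weight w [set e; mate e] = w e + w (mate e).
Proof. by rewrite /weight big_setU1 ?big_set1 //= inE eq_sym mate_neq. Qed.

Definition tight {d} (w : ground d -> nat) h := forall e, w e + w (mate e) = h.

Lemma tau_tight d (C : {set {set ground d}}) w h : 0 < d -> cuboid C ->
  tight w h -> h <= tau C w -> tau C w = h.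
Proof.
move=> d0 hC tw hw; apply/eqP; rewrite eqn_leq hw andbT.
have [_ min] := tauP w (cuboid_set0 d0 hC).
have e : ground d := (Ordinal d0, false).
by rewrite -(tw e) -weight_pair; apply: min; apply: cover_pair.
Qed.

(** The union of [B :\ e] and [B' :\ mate e] is a cover, since a member avoids
    one of [e] and [mate e] and meets the corresponding cover elsewhere; its
    weight is at most [2 h - (w e + w (mate e)) < h]. *)
Lemma uncross d (C : {set {set ground d}}) w h e B B' :
    0 < d -> cuboid C -> h <= tau C w -> h < w e + w (mate e) ->
    is_cover C B -> e \in B -> weight w B <= h ->
    is_cover C B' -> mate e \in B' -> weight w B' <= h -> False.
Proof.
move=> d0 hC hw he /forall_inP cB eB wB /forall_inP cB' eB' wB'.
have [_ min] := tauP w (cuboid_set0 d0 hC).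
have cD : is_cover C ((B :\ e) :|: (B' :\ mate e)).
  apply/forall_inP => A AC; apply/set0Pn.
  have := in_mate e hC AC; case: (boolP (e \in A)) => [eA|eA] mA.
    have /set0Pn[x] := cB' A AC; rewrite inE => /andP[xA xB].
    exists x; rewrite !inE xA xB /=; have [xe|] := eqVneq x (mate e).
      by rewrite -xe xA in mA.
    by rewrite orbT.
  have /set0Pn[x] := cB A AC; rewrite inE => /andP[xA xB].
  exists x; rewrite !inE xA xB /=; have [xe|//] := eqVneq x e.
  by rewrite -xe xA in eA.
have := min _ cD.
have sub : weight w ((B :\ e) :|: (B' :\ mate e)) <=
    weight w (B :\ e) + weight w (B' :\ mate e).
  rewrite /weight [leqLHS]big_mkcond [X in _ <= X + _]big_mkcond.
  rewrite [X in _ <= _ + X]big_mkcond -big_split /=.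
  by apply: leq_sum => x _; rewrite in_setU; case: (x \in _) => /=;
     case: ifP => _; lia.
have wD x (X : {set ground d}) : x \in X -> weight w X = w x + weight w (X :\ x).
  by move=> xX; rewrite /weight (big_setD1 x).
have := wD _ _ eB; have := wD _ _ eB'; lia.
Qed.

(** Lowering single entries of [w] as long as [tau] stays at least [h] can only
    stop at a tight weight, by [uncross]. *)
Lemma tight_reduction d (C : {set {set ground d}}) w h :
    0 < d -> cuboid C -> h <= tau C w ->
  exists w', [/\ forall e, w' e <= w e, tight w' h & tau C w' = h].
Proof.
move=> d0 hC; have C0 := cuboid_set0 d0 hC.
have [n] := ubnP (\sum_e w e); elim: n w => // n IHn w /ltnSE le_n hw.
have [tw|/existsNP[e not_tight]] := pselect (tight w h).
  by exists w; split => //; apply: tau_tight hw.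
have gt_e : h < w e + w (mate e).
  have [_ min] := tauP w C0.
  have := min _ (cover_pair e hC); rewrite weight_pair; lia.
(* What prevents lowering [w] at [f] is a cover through [f] that is already
   as light as allowed. *)
have dec f : w f = 0 \/ (exists w', [/\ forall e, w' e <= w e, tight w' h
    & tau C w' = h]) \/ exists B, [/\ is_cover C B, f \in B & weight w B <= h].
  have [->|wf] := posnP (w f); [by left | right].
  have w1 x : x \in [set f] -> 0 < w x by move=> /set1P->.
  pose wf1 x := w x - (x \in [set f]).
  have [hw1|] := leqP h (tau C wf1).
    left; have [|w' [le1 tw' tauw']] := IHn wf1 _ hw1.
      apply: leq_trans le_n; rewrite (bigD1 f) //= [ltnRHS](bigD1 f) //=.
      rewrite -addSn leq_add //; first by rewrite /wf1 set11; lia.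
      by apply: leq_sum => x _; exact: leq_subr.
    by exists w'; split => // x; apply: leq_trans (le1 x) (leq_subr _ _).
  have [[B cB <-] _] := tauP wf1 C0; have := weight_sub B w1; rewrite -/wf1.
  have [_ min] := tauP w C0; have := min _ cB.
  have := subset_leq_card (subsetIl [set f] B); rewrite cards1.
  case: (boolP (f \in B)) => fB; first by right; exists B; split => //; lia.
  suff -> : [set f] :&: B = set0 by rewrite cards0; lia.
  by apply/setP => x; rewrite !inE; case: eqP fB => // -> /negPf.
have w_in f (B : {set ground d}) : f \in B -> w f <= weight w B.
  by move=> fB; rewrite /weight (bigD1 f) //= leq_addr.
have [we|[//|[B [cB eB wB]]]] := dec e.
  have [wm|[//|[B [_ /w_in]]]] := dec (mate e); lia.
have [wm|[//|[B' [cB' eB' wB']]]] := dec (mate e).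
  by have := w_in _ _ eB; lia.
by case: (uncross d0 hC hw gt_e cB eB wB cB' eB' wB').
Qed.

Local Open Scope ring_scope.

(** * Conic combinations over the rationals *)

(** The pivot shared by the arguments on supports and on vertices: moving from a
    nonnegative [s] in a direction [q] with a negative entry, one stops when the
    first decreasing coordinate vanishes. *)
Lemma ratio_test (I : finType) (s q : I -> rat) :
    (forall i, 0 <= s i) -> (exists i, q i < 0) ->
  exists eps, [/\ 0 <= eps, forall i, 0 <= s i + eps * q i
    & exists2 i, q i < 0 & s i + eps * q i = 0].
Proof.
move=> s0 [i0 qi0].
pose F i := s i / (- q i).
case: (@arg_minP _ _ _ i0 (fun i => q i < 0) F qi0) => i qi mini.
exists (F i); split.
- by rewrite /F divr_ge0 // oppr_ge0 ltW.
- move=> k; have [qk|qk] := ltP (q k) 0.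
    have := mini k qk; rewrite {2}/F ler_pdivlMr ?oppr_gt0 //.
    by rewrite mulrN lerNl -subr_ge0 opprK addrC.
  by rewrite addr_ge0 // mulr_ge0 // divr_ge0 // oppr_ge0 ltW.
- exists i => //; rewrite /F invrN mulrN mulNr divfK ?subrr //.
  by rewrite lt_eqF.
Qed.

(** Farkas' lemma, by induction on the generators. If [f] separates [b] from the
    cone of [s] but is negative on the new generator [a n], project everything
    along [a n] onto the hyperplane where [f] vanishes; a representation or a
    separating functional for the projected data lifts back. *)
Lemma farkas (I J : finType) (s : seq J) (a : J -> I -> rat) (b : I -> rat) :
    uniq s ->
  (exists2 c : J -> rat, forall j, 0 <= c j
     & forall i, b i = \sum_(j <- s) c j * a j i) \/
  (exists2 f : I -> rat, forall j, j \in s -> 0 <= \sum_i f i * a j i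
     & \sum_i f i * b i < 0).
Proof.
elim: s a b => [|n s IHs] a b /=.
  move=> _; have [b0|/existsNP [i bi]] := pselect (forall i, b i = 0).
    by left; exists (fun=> 0) => // i; rewrite big_nil b0.
  right; exists (fun i => - b i) => //.
  under eq_bigr do rewrite mulNr -expr2.
  rewrite sumrN oppr_lt0 lt_neqAle sumr_ge0 ?andbT; last first.
    by move=> k _; exact: sqr_ge0.
  rewrite eq_sym psumr_neq0; last by move=> k _; exact: sqr_ge0.
  by apply/hasP; exists i; rewrite ?mem_index_enum //= exprn_even_gt0 //=; exact/eqP.
case/andP=> ns us.
have extend (c : J -> rat) x i :
    \sum_(j <- n :: s) (if j == n then x else c j) * a j i
    = x * a n i + \sum_(j <- s) c j * a j i.
  rewrite big_cons eqxx; congr (_ + _); apply: eq_big_seq => j js.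
  by case: eqP js ns => // -> ->.
have extend_ge0 (c : J -> rat) x : (forall j, 0 <= c j) -> 0 <= x ->
    forall j, 0 <= (if j == n then x else c j).
  by move=> c0 x0 j; case: ifP.
have [[c c0 cb]|[f fa fb]] := IHs a b us.
  left; exists (fun j => if j == n then 0 else c j); first exact: extend_ge0.
  by move=> i; rewrite extend mul0r add0r.
have [fn|fn] := leP 0 (\sum_i f i * a n i).
  by right; exists f => // j; rewrite inE => /predU1P[->|/fa].
pose dot (u v : I -> rat) := \sum_i u i * v i.
have dotD u x v y v' : dot u (fun i => x * v i + y * v' i)
    = x * dot u v + y * dot u v'.
  by rewrite /dot !mulr_sumr -big_split /=; apply: eq_bigr => i _; ring.
have [[c c0 cb]|[g ga gb]] := IHs
    (fun j i => - dot f (a n) * a j i + dot f (a j) * a n i)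
    (fun i => - dot f (a n) * b i + dot f b * a n i) us.
  left; exists (fun j => if j == n then
      (\sum_(j <- s) c j * dot f (a j) - dot f b) / - dot f (a n) else c j).
    apply: extend_ge0 => //; apply: divr_ge0; last by rewrite oppr_ge0 ltW.
    rewrite subr_ge0; apply: le_trans (ltW fb) _.
    by rewrite big_seq sumr_ge0 // => j js; rewrite mulr_ge0 // fa.
  have fn0 : - dot f (a n) != 0 by rewrite oppr_eq0 lt_eqF.
  move=> i; rewrite extend; apply: (mulfI fn0).
  have -> : - dot f (a n) * b i = - dot f b * a n i
     + (- dot f (a n) * b i + dot f b * a n i) by ring.
  rewrite cb; under [X in _ + X = _]eq_bigr do
    rewrite mulrDr mulrCA [X in _ + X]mulrA.
  rewrite big_split /= -mulr_sumr -mulr_suml.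
  set X := \sum_(j <- s) _; set Y := \sum_(j <- s) _.
  by rewrite mulrDr mulrA [_ * (_ / _)]mulrC divfK //; ring.
(* [g] precomposed with the projection along [a n]. *)
have dotg v : \sum_i (- dot f (a n) * g i + dot g (a n) * f i) * v i
    = dot g (fun i => - dot f (a n) * v i + dot f v * a n i).
  rewrite dotD /= [dot f v * _]mulrC {2 4}/dot !mulr_sumr -big_split /=.
  by rewrite -/(dot g (a n)); apply: eq_bigr => i _; ring.
right; exists (fun i => - dot f (a n) * g i + dot g (a n) * f i); rewrite ?dotg //.
move=> j; rewrite inE dotg => /predU1P[->|/ga //].
rewrite /dot big1 // => i _.
by ring.
Qed.

Lemma linear_dependency (I J : finType) (X : {set J}) (a : J -> I -> rat) :
    (#|I| < #|X|)%N ->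
  exists c : J -> rat, [/\ exists2 j, j \in X & c j != 0,
    forall j, j \notin X -> c j = 0
    & forall i, \sum_(j in X) c j * a j i = 0].
Proof.
move=> ltIX.
pose M := \matrix_(r < #|X|, i < #|I|) a (enum_val r) (enum_val i).
have : kermx M != 0.
  rewrite kermx_eq0 /row_free ltn_eqF //.
  exact: leq_ltn_trans (rank_leq_col _) ltIX.
case/matrix0Pn=> r [k Krk].
have kX : enum_val k \in X := enum_valP k.
exists (fun j => if j \in X then kermx M r (enum_rank_in kX j) else 0); split.
- by exists (enum_val k); rewrite ?kX ?enum_valK_in.
- by move=> j /negPf->.
move=> i; rewrite big_enum_val /=.
have /matrixP/(_ r (enum_rank i)) := mulmx_ker M; rewrite !mxE => ker0.
rewrite -[RHS]ker0.
by apply: eq_bigr => l _; rewrite enum_valP enum_valK_in !mxE enum_rankK.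
Qed.

(** * Fractional packings of a cuboid *)

(** The amount of each element used by a fractional packing [c]; only the values
    of [c] on members of [C] count. *)
Definition load (E : finType) (C : {set {set E}}) (c : {set E} -> rat)
    (e : E) : rat :=
  \sum_(A in C | e \in A) c A.

Definition supp (E : finType) (C : {set {set E}}) (c : {set E} -> rat) :=
  [set A in C | c A != 0].

Lemma sum_supp (E : finType) (C : {set {set E}}) c (P : pred {set E}) :
  \sum_(A in supp C c | P A) c A = \sum_(A in C | P A) c A.
Proof.
rewrite [LHS]big_mkcond [RHS]big_mkcond; apply: eq_bigr => A _ /=.
rewrite inE; case: (A \in C) => //=; case: (P A); rewrite ?andbF ?andbT //.
by case: eqVneq => //= ->.
Qed.

Lemma sum_load (E : finType) (C : {set {set E}}) c (B : {set E}) :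
  \sum_(e in B) load C c e = \sum_(A in C) c A * #|A :&: B|%:R.
Proof.
rewrite /load (exchange_big_dep (mem C)) /=; last by move=> e A _ /andP[].
apply: eq_bigr => A inC; rewrite inC /= mulr_natr -sumr_const.
by apply: eq_bigl => e; rewrite inE andbC.
Qed.

Lemma dot_load (E : finType) (C : {set {set E}}) (p : E -> rat) c :
  \sum_e p e * load C c e = \sum_(A in C) c A * \sum_(e in A) p e.
Proof.
under eq_bigr do rewrite mulr_sumr.
rewrite (exchange_big_dep (mem C)) /=; last by move=> e A _ /andP[].
apply: eq_bigr => A inC; rewrite mulr_sumr inC /=.
by apply: eq_bigr => e _; rewrite mulrC.
Qed.

Lemma load_mate d (C : {set {set ground d}}) c e : cuboid C ->
  load C c (mate e) = \sum_(A in C) c A - load C c e.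
Proof.
move=> hC; rewrite /load.
rewrite [X in _ = X - _](bigID (fun A : {set ground d} => e \in A)) /=.
rewrite addrAC subrr add0r.
apply: eq_bigl => A; case: (boolP (A \in C)) => //= AC.
by rewrite (in_mate _ hC AC).
Qed.

(** Caratheodory's theorem with the dimension of the linear span of a cuboid: the
    load on [bar i] is the total minus the load on [elt i], so [d] loads and the
    total determine everything, and more than [d + 1] members are linearly
    dependent. *)
Lemma caratheodory d (C : {set {set ground d}}) (c : {set ground d} -> rat) :
    cuboid C -> (forall A, 0 <= c A) ->
  exists c' : {set ground d} -> rat, [/\ forall A, 0 <= c' A,
    forall A, c A = 0 -> c' A = 0,
    forall e, load C c' e = load C c e,
    \sum_(A in C) c' A = \sum_(A in C) c A
    & (#|supp C c'| <= d.+1)%N].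
Proof.
move=> hC; have [n] := ubnP #|supp C c|.
elim: n c => // n IHn c /ltnSE le_n c0; set X := supp C c in le_n.
have [leX|gtX] := leqP #|X| d.+1; first by exists c; split.
pose a (A : {set ground d}) (o : option 'I_d) : rat :=
  if o is Some i then (elt i \in A)%:R else 1.
have [|g [[A0 A0X gA0] gX gsum]] := @linear_dependency _ _ X a.
  by rewrite card_option card_ord.
have XC A : A \in X -> A \in C by rewrite inE => /andP[].
have gC (P : pred {set ground d}) :
    \sum_(A in C | P A) g A = \sum_(A in X) g A * (P A)%:R.
  rewrite big_mkcondr /= [RHS]big_mkcond [LHS]big_mkcond /=.
  apply: eq_bigr => A _; case: (boolP (A \in X)) => [AX|/gX->].
    by rewrite (XC _ AX); case: (P A); rewrite ?mulr1 ?mulr0.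
  by case: (A \in C); case: (P A).
have g_tot : \sum_(A in C) g A = 0.
  under eq_bigl do rewrite -[_ \in C]andbT.
  by rewrite (gC predT) -[RHS](gsum None).
have g_load e : load C g e = 0.
  have elt0 i : load C g (elt i) = 0 by rewrite /load gC -[RHS](gsum (Some i)).
  case: e => i []; last exact: elt0.
  by rewrite -[(i, true)]/(mate (elt i)) load_mate // g_tot elt0 subr0.
have /ratio_test-/(_ c c0) [eps [eps0 ge0 [A1 gA1 cA1]]] : exists A, g A < 0.
  apply: contrapT => /forallNP g_ge0; move: gA0.
  have g0 A : 0 <= g A by rewrite leNgt; apply/negP/g_ge0.
  by move: g_tot => /(psumr_eq0P (fun A _ => g0 A)) -> //; rewrite ?eqxx ?XC.
pose c1 A := c A + eps * g A.
have c1E P : \sum_(A in C | P A) c1 A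
    = \sum_(A in C | P A) c A + eps * \sum_(A in C | P A) g A.
  by rewrite big_split /= mulr_sumr.
have c1X A : c A = 0 -> c1 A = 0.
  by move=> cA; rewrite /c1 cA gX ?mulr0 ?addr0 // inE cA eqxx andbF.
have [|A|c2 [c2_0 c2X c2l c2t c2n]] := IHn c1; [|exact: ge0|].
  apply: leq_trans le_n; apply: proper_card; apply/properP; split.
    apply/subsetP => A; rewrite !inE => /andP[->] /=.
    exact/contra_neq/c1X.
  exists A1; last by rewrite inE /c1 cA1 eqxx andbF.
  by apply: contraTT gA1 => /gX ->; rewrite ltxx.
exists c2; split => //.
- by move=> A /c1X/c2X.
- by move=> e; rewrite c2l /load c1E -/(load C g e) g_load mulr0 addr0.
- by rewrite c2t /c1 big_split /= -mulr_sumr g_tot mulr0 addr0.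
Qed.

(** * Fractional covers lighter than tau *)

Definition fractional_cover (E : finType) (C : {set {set E}}) (p : E -> rat) :=
  (forall e, 0 <= p e) /\ (forall A, A \in C -> 1 <= \sum_(e in A) p e).

(** Linear programming duality, from [farkas] in dimension [|E| + 1]: the extra
    coordinate records the value of the packing, and the generators [inr e] are
    the slacks of the capacity constraints. *)
Lemma packing_or_cover (E : finType) (C : {set {set E}}) (w : E -> nat) (h : nat) :
  (exists c : {set E} -> rat, [/\ forall A, 0 <= c A,
     forall e, load C c e <= (w e)%:R & \sum_(A in C) c A = h%:R]) \/
  (exists2 p, fractional_cover C p & \sum_e p e * (w e)%:R < h%:R).
Proof.
pose a (j : {set E} + E) (i : option E) : rat :=
  match j, i with
  | inl A, Some e => (e \in A)%:R
  | inl A, None => 1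
  | inr e', Some e => (e == e')%:R
  | inr e', None => 0
  end.
pose b (i : option E) : rat := if i is Some e then (w e)%:R else h%:R.
pose s : seq ({set E} + E) := [seq inl A | A <- enum C] ++ [seq inr e | e <- enum E].
have us : uniq s.
  rewrite cat_uniq !map_inj_uniq ?enum_uniq //=; try by move=> x y [].
  rewrite -enumT enum_uniq andbT.
  by apply/hasPn => x /mapP[e _ ->]; apply/negP => /mapP[].
have sumE (F : option E -> rat) : \sum_i F i = F None + \sum_e F (Some e).
  rewrite (bigD1 None) //=; congr (_ + _).
  rewrite (reindex_omap Some id); last by case.
  by apply: eq_bigl => e; rewrite eqxx.
have [[c c0 cb]|[f fa fb]] := farkas a b us.
  left; exists (c \o inl); split=> [A|e|]; first exact: c0.
    have := cb (Some e); rewrite big_cat !big_map !big_enum /= => ->.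
    rewrite /load big_mkcondr /= -[leLHS]addr0 lerD //.
      by apply: ler_sum => A _; case: (e \in A); rewrite ?mulr1 ?mulr0.
    by apply: sumr_ge0 => e' _; rewrite mulr_ge0.
  have := cb None; rewrite big_cat !big_map !big_enum /= => ->.
  rewrite [X in _ + X]big1 ?addr0; last by move=> e _; rewrite mulr0.
  by apply: eq_bigr => A _; rewrite mulr1.
right; move: fb; rewrite sumE /b /= => fb.
have f0 e : 0 <= f (Some e).
  have /fa : inr e \in s by rewrite mem_cat map_f ?orbT ?mem_enum.
  rewrite sumE /= mulr0 add0r (bigD1 e) //= eqxx mulr1 big1 ?addr0 // => e' /negPf->.
  by rewrite mulr0.
have fA A : A \in C -> 0 <= f None + \sum_(e in A) f (Some e).
  move=> inC; have /fa : inl A \in s by rewrite mem_cat map_f ?mem_enum.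
  rewrite sumE /= mulr1 [in X in _ -> X]big_mkcond /=.
  by under eq_bigr do rewrite mulr_natr mulrb.
have sum0 : 0 <= \sum_e f (Some e) * (w e)%:R
  by apply: sumr_ge0 => e _; rewrite mulr_ge0.
have k0 : 0 < - f None.
  rewrite oppr_gt0 ltNge; apply/negP => fN.
  by have := mulr_ge0 fN (ler0n rat h); lra.
exists (fun e => f (Some e) / - f None).
  split=> [e|A inC]; first by rewrite divr_ge0 // ltW.
  by rewrite -mulr_suml ler_pdivlMr // mul1r -subr_ge0 opprK addrC fA.
under eq_bigr do rewrite mulrAC.
by rewrite -mulr_suml ltr_pdivrMr // mulrN -subr_gt0; lra.
Qed.

(** The constraints that are tight at [p] determine [p], expressed as the absence
    of a nonzero direction along which they all remain tight. *)
Definition vertex (E : finType) (C : {set {set E}}) (p : E -> rat) :=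
  forall q : E -> rat,
    (forall A, A \in C -> \sum_(e in A) p e = 1 -> \sum_(e in A) q e = 0) ->
    (forall e, p e = 0 -> q e = 0) -> forall e, q e = 0.

(** While [p] is not a vertex, a direction that preserves all tight constraints
    can be oriented so that the cost does not increase and some entry decreases;
    following it makes a further constraint tight. *)
Lemma exists_vertex (E : finType) (C : {set {set E}}) (w : E -> nat) p :
    fractional_cover C p ->
  exists p', [/\ fractional_cover C p', vertex C p'
    & \sum_e p' e * (w e)%:R <= \sum_e p e * (w e)%:R].
Proof.
pose slope (q : E -> rat) (x : {set E} + E) : rat :=
  match x with
  | inl A => if A \in C then \sum_(e in A) q e else 0
  | inr e => q e
  end.
pose slack p (x : {set E} + E) : rat :=
  slope p x - (if x is inl A then (A \in C)%:R else 0).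
have slackP p' : fractional_cover C p' <-> forall x, 0 <= slack p' x.
  split=> [[p0 pA] [A|e]|sl].
  - by rewrite /slack /=; case: ifP => [/pA|]; rewrite ?subr_ge0 // subrr.
  - by rewrite /slack /= subr0.
  - split=> [e|A inC]; first by have := sl (inr e); rewrite /slack /= subr0.
    by have := sl (inl A); rewrite /slack /= inC subr_ge0.
have [n] := ubnP #|[set x | slack p x != 0]|.
elim: n p => // n IHn p /ltnSE le_n cov.
have [vp|/existsNP[q]] := pselect (vertex C p); first by exists p.
move/not_implyP=> [qA /not_implyP[q0 /existsNP[e1 /eqP qe1]]].
pose dot (u : E -> rat) := \sum_e u e * (w e)%:R.
have [r [r_tight r_dot [e r_e]]] : exists r : E -> rat,
    [/\ forall x, slack p x = 0 -> slope r x = 0, dot r <= 0 & exists e, r e < 0].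
  have q_tight x : slack p x = 0 -> slope q x = 0.
    case: x => [A|e]; rewrite /slack /=; last by rewrite subr0 => /q0.
    by case: ifP => // inC /eqP; rewrite subr_eq0 => /eqP/(qA _ inC).
  have slopeN x : slope (fun e => - q e) x = - slope q x.
    by case: x => [A|e] //=; case: ifP; rewrite ?sumrN ?oppr0.
  have dotN : dot (fun e => - q e) = - dot q.
    by rewrite /dot -sumrN; apply: eq_bigr => e _; rewrite mulNr.
  have neg (u : E -> rat) : dot u < 0 -> exists e, u e < 0.
    move=> du; apply: contrapT => /forallNP u0; move: du; apply/negP.
    rewrite -leNgt sumr_ge0 // => e _; rewrite mulr_ge0 // leNgt.
    exact/negP/u0.
  have tightN x : slack p x = 0 -> slope (fun e => - q e) x = 0.
    by move=> /q_tight qx; rewrite slopeN qx oppr0.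
  have [dq|dq|dq] := ltgtP (dot q) 0.
  - by exists q; split; [exact: q_tight | exact: ltW | exact: neg].
  - exists (fun e => - q e); split => //; first by rewrite dotN oppr_le0 ltW.
    by apply: neg; rewrite dotN oppr_lt0.
  - have [qe|qe|qe] := ltgtP (q e1) 0.
    + by exists q; split; [exact: q_tight | rewrite dq | exists e1].
    + exists (fun e => - q e); split => //; first by rewrite dotN dq oppr0.
      by exists e1; rewrite oppr_lt0.
    + by rewrite qe eqxx in qe1.
have [||eps [eps0 ge0 [x1 rx1 x1_0]]] := @ratio_test _ (slack p) (slope r).
- exact/slackP.
- by exists (inr e).
pose p1 e := p e + eps * r e.
have slack1 x : slack p1 x = slack p x + eps * slope r x.
  case: x => [A|e'] /=; last by rewrite /slack /= !subr0.
  rewrite /slack /=; case: ifP => _; last by rewrite mulr0 addr0.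
  by rewrite /p1 big_split -mulr_sumr /=; ring.
have [||p2 [cov2 v2 le2]] := IHn p1.
- apply: leq_trans le_n; apply/proper_card/properP; split.
    apply/subsetP => x; rewrite !inE; apply: contra_neq => sx.
    by rewrite slack1 sx r_tight // mulr0 addr0.
  exists x1; last by rewrite inE slack1 x1_0 eqxx.
  by rewrite inE; apply: contraTneq rx1 => /r_tight ->; rewrite ltxx.
- by apply/slackP => x; rewrite slack1.
exists p2; split => //; apply: le_trans le2 _.
under eq_bigr do rewrite mulrDl -mulrA.
by rewrite big_split /= -mulr_sumr gerDl mulr_ge0_le0.
Qed.

(** At a vertex the tight constraints span the dual space, so modulo the
    coordinates where [p] vanishes every unit vector is a combination of tight
    members. [farkas] is used with the generators [A] and [- A], for which a
    separating functional would be a direction excluded by [vertex]. *)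
Lemma vertex_span (E : finType) (C : {set {set E}}) (p : E -> rat) e0 :
    vertex C p -> p e0 != 0 ->
  exists2 c : {set E} -> rat,
    forall A, c A != 0 -> A \in C /\ \sum_(e in A) p e = 1
    & forall e, p e != 0 -> load C c e = (e == e0)%:R.
Proof.
move=> vp pe0.
pose T := [set A in C | \sum_(e in A) p e == 1].
pose a (j : {set E} * bool) (e : E) : rat :=
  (-1) ^+ j.2 * ((e \in j.1) && (p e != 0))%:R.
pose s := [seq (A, b) | A <- enum T, b <- [:: false; true]].
have us : uniq s.
  by apply: allpairs_uniq => //; rewrite ?enum_uniq // => -[x1 x2] [y1 y2] _ _ [-> ->].
have inS A b : A \in T -> (A, b) \in s.
  by move=> AT; apply/allpairsP; exists (A, b); rewrite /= mem_enum AT; case: (b).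
have [[c c0 cb]|[f fa fb]] := farkas a (fun e => (e == e0)%:R) us.
  exists (fun A => if A \in T then c (A, false) - c (A, true) else 0).
    move=> A; case: ifP; rewrite ?eqxx // inE => /andP[inC /eqP pA] _.
    by split.
  move=> e pe; rewrite cb big_allpairs big_enum /= /load.
  rewrite big_mkcondr /= big_mkcond [RHS]big_mkcond /=; apply: eq_bigr => A _.
  rewrite inE; case: (A \in C) => //=; case: (_ == 1) => /=; last by rewrite if_same.
  rewrite !big_cons big_nil /a /= pe andbT.
  by case: (e \in A); rewrite /= ?mulr0 ?addr0 //; ring.
exfalso; pose q e := if p e != 0 then f e else 0.
have sumA A b : \sum_i f i * a (A, b) i = (-1) ^+ b * \sum_(e in A) q e.
  rewrite [in RHS]big_mkcond mulr_sumr; apply: eq_bigr => e _; rewrite /a /q /=.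
  by case: (e \in A); case: (p e != 0) => /=; ring.
have q_A A : A \in C -> \sum_(e in A) p e = 1 -> \sum_(e in A) q e = 0.
  move=> inC pA; have AT : A \in T by rewrite inE inC pA eqxx.
  have := fa _ (inS A true AT); have := fa _ (inS A false AT).
  rewrite !sumA; lra.
have := vp q q_A _ e0; rewrite /q pe0 => fe0.
move: fb; rewrite (bigD1 e0) //= fe0 ?mul0r ?add0r; last by move=> e ->; rewrite eqxx.
by rewrite big1 ?ltxx // => e /negPf->; rewrite mulr0.
Qed.

Definition frac (x : rat) : rat := x - (Num.floor x)%:~R.

Lemma frac_ge0 x : 0 <= frac x.
Proof. by rewrite subr_ge0 floor_le. Qed.

Lemma frac_int x : x - frac x \is a Num.int.
Proof. by rewrite /frac opprB addrC subrK rpred_int. Qed.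

Lemma frac0 : frac 0 = 0.
Proof. by rewrite /frac floor0 subrr. Qed.

Lemma frac_opp_le1 x : frac x + frac (- x) <= 1.
Proof.
have x1 := floorD1_gt x; have y1 := floorD1_gt (- x).
have : (- (Num.floor x + Num.floor (- x)))%:~R < 2%:~R :> rat.
  by move: x1 y1; rewrite rmorphN !rmorphD /=; lra.
rewrite ltr_int /frac => lt2.
have : (- (Num.floor x + Num.floor (- x)))%:~R <= 1%:~R :> rat.
  by rewrite ler_int; lia.
by rewrite rmorphN rmorphD /=; lra.
Qed.

Lemma load_sub_int (E : finType) (C : {set {set E}}) c c' :
  (forall A, c A - c' A \is a Num.int) ->
  forall e, load C c e - load C c' e \is a Num.int.
Proof. by move=> cc e; rewrite -sumrB rpred_sum. Qed.

(** With [w] the load of [c] rounded up and [sigma] the total of [c]: every cover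
    has weight at least [sigma], hence at least its ceiling, while weighting by
    [p] bounds every packing by [sigma], because rounding only changes elements
    on which [p] vanishes. *)
Lemma roundup_not_packed d (C : {set {set ground d}}) p c :
    (0 < d)%N -> cuboid C -> fractional_cover C p -> (forall A, 0 <= c A) ->
    (forall A, c A != 0 -> A \in C /\ \sum_(e in A) p e = 1) ->
    (forall e, p e != 0 -> load C c e \is a Num.int) ->
    \sum_(A in C) c A \isn't a Num.int ->
  exists w h, [/\ tight w h, tau C w = h, ~ packed C w h
    & h%:R < \sum_(A in C) c A + 1].
Proof.
move=> d0 hC [p0 pA] c0 cT loadZ; set sigma := \sum_(A in C) c A => sigmaZ.
have C0 := cuboid_set0 d0 hC.
have load_ge0 e : 0 <= load C c e by apply: sumr_ge0.
have sigma_ge0 : 0 <= sigma by apply: sumr_ge0.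
pose up (x : rat) := `|Num.ceil x|%N.
have upE x : 0 <= x -> (up x)%:R = (Num.ceil x)%:~R :> rat.
  by move=> x0; rewrite /up pmulrn gez0_abs // ceil_ge0; apply: lt_le_trans x0.
have le_up x : 0 <= x -> x <= (up x)%:R by move=> x0; rewrite upE // ceil_ge.
pose w e := up (load C c e); pose h := up sigma.
have hlt : h%:R < sigma + 1.
  by have := ceilB1_lt sigma; rewrite /h upE // intrB; lra.
have hgt : sigma < h%:R.
  rewrite lt_neqAle le_up // andbT; apply: contraNneq sigmaZ => ->.
  exact: natr_int.
have htau : (h <= tau C w)%N.
  apply: leq_tau => // B /forall_inP cB.
  rewrite -ltnS -(ltr_nat rat) -natr1; apply: lt_le_trans hlt _.
  rewrite lerD2r /weight natr_sum.
  apply: (@le_trans _ _ (\sum_(e in B) load C c e)); last first.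
    by apply: ler_sum => e _; apply: le_up.
  rewrite sum_load; apply: ler_sum => A inC.
  by rewrite ler_peMr // ler1n card_gt0 cB.
have not_packed : ~ packed C w h.
  move=> [y yw yh]; move: hgt; apply/negP; rewrite -leNgt -yh natr_sum.
  apply: (@le_trans _ _ (\sum_e p e * load C (fun A => (y A)%:R) e)).
    rewrite dot_load; apply: ler_sum => A inC.
    by rewrite ler_peMr // pA.
  apply: (@le_trans _ _ (\sum_e p e * load C c e)).
    apply: ler_sum => e _; have [->|pe] := eqVneq (p e) 0; first by rewrite !mul0r.
    rewrite ler_wpM2l // /load -natr_sum.
    apply: (@le_trans _ _ (w e)%:R); first by rewrite ler_nat.
    by rewrite /w upE // ceilK // loadZ.
  rewrite dot_load ler_sum // => A inC.
  by have [->|/cT[_ ->]] := eqVneq (c A) 0; rewrite ?mul0r ?mulr1.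
have [w' [w'w tw' tauw']] := tight_reduction d0 hC htau.
exists w', h; split => // pk; exact/not_packed/(packed_le w'w).
Qed.

(** A fractional cover lighter than every cover yields a weight of small height
    that does not pack: the height is about half the number of members used,
    because the fractional parts of [c A] and of [- c A] add up to at most 1. *)
Lemma nonideal_witness d (C : {set {set ground d}}) p (w : ground d -> nat) :
    (0 < d)%N -> cuboid C -> fractional_cover C p ->
    \sum_e p e * (w e)%:R < (tau C w)%:R ->
  exists w' h, [/\ tight w' h, tau C w' = h, ~ packed C w' h & (2 * h <= d.+2)%N].
Proof.
move=> d0 hC covp0 lt0; have C0 := cuboid_set0 d0 hC.
have [{covp0 lt0}p [[p0 pA] vp lt_tau]] : exists p, [/\ fractional_cover C p,
    vertex C p & \sum_e p e * (w e)%:R < (tau C w)%:R].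
  have [p' [cov' v' le']] := exists_vertex w covp0.
  by exists p'; split => //; apply: le_lt_trans lt0.
(* If [p] were integral, its support would be a cover of weight at most [p * w]. *)
have [e0 pe0] : exists e, p e \isn't a Num.int.
  apply: contrapT => /forallNP pZ; move: lt_tau; apply/negP; rewrite -leNgt.
  have [_ min] := tauP w C0.
  pose B := [set e | p e != 0].
  have cB : is_cover C B.
    apply/forall_inP => A inC; apply/set0Pn; apply: contrapT => /forallNP AB.
    have := pA A inC; rewrite big1 ?ler10 // => e eA.
    by apply/eqP; apply: contraPT (AB e) => pe; rewrite !inE eA pe.
  have := min B cB; rewrite -(ler_nat rat) => /le_trans; apply.
  rewrite /weight natr_sum big_mkcond /=; apply: ler_sum => e _.
  rewrite inE; case: eqVneq => [->|pe] /=; first by rewrite mul0r.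
  rewrite ler_peMl //; move: (pZ e) => /negP; rewrite negbK => /intrP[z zE].
  move: (p0 e) pe; rewrite zE (ler0z rat) intr_eq0 (ler_int rat 1).
  by move=> z0 zn; lia.
have pe0n : p e0 != 0 by apply: contraNneq pe0 => ->; rewrite rpred0.
have [a aT aload] := vertex_span vp pe0n.
(* Pair the identity for the unit vector of [e0] with [p]. *)
have sum_a : \sum_(A in C) a A = p e0.
  transitivity (\sum_(A in C) a A * \sum_(e in A) p e).
    by apply: eq_bigr => A _; have [->|/aT[_ ->]] := eqVneq (a A) 0;
       rewrite ?mul0r ?mulr1.
  rewrite -dot_load (bigD1 e0) //= aload // eqxx mulr1 big1 ?addr0 // => e ee0.
  by have [->|pe] := eqVneq (p e) 0; rewrite ?mul0r // aload // (negPf ee0) mulr0.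
have cT (x : {set ground d} -> rat) A : (a A = 0 -> x A = 0) -> x A != 0 ->
    A \in C /\ \sum_(e in A) p e = 1.
  by move=> ax xA; apply: aT; apply: contra_neq xA.
have [c [c0 ca c_load c_sum c_supp]] := caratheodory hC (fun A => frac_ge0 (a A)).
have ac A : a A = 0 -> c A = 0 by move=> aA; apply: ca; rewrite aA frac0.
have cZ e : p e != 0 -> load C c e \is a Num.int.
  move=> pe; rewrite c_load -[load _ _ _](subrK (load C a e)).
  rewrite rpredD ?aload ?rpred_nat // -rpredN opprB -(aload e pe).
  by apply: load_sub_int => A; apply: frac_int.
have sumZ (x y : {set ground d} -> rat) : (forall A, x A - y A \is a Num.int) ->
    \sum_(A in C) x A \isn't a Num.int -> \sum_(A in C) y A \isn't a Num.int.
  move=> xy; apply: contra => yZ.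
  by rewrite -[X in X \is a _](subrK (\sum_(A in C) y A)) rpredD // -sumrB rpred_sum.
have cNZ : \sum_(A in C) c A \isn't a Num.int.
  by rewrite c_sum; apply: (sumZ a) => [A|]; [exact: frac_int | rewrite sum_a].
pose c1 A := frac (c A); pose c2 A := frac (- c A).
have [c' [c'0 c'T c'load c'sum c'half]] : exists c' : {set ground d} -> rat,
  [/\ forall A, 0 <= c' A, forall A, c A = 0 -> c' A = 0,
    forall e, p e != 0 -> load C c' e \is a Num.int,
    \sum_(A in C) c' A \isn't a Num.int
    & 2 * \sum_(A in C) c' A <= d.+1%:R].
  (* Taking fractional parts changes loads and total by integers. *)
  have fracP (x : {set ground d} -> rat) : (forall A, c A = 0 -> x A = 0) ->
      (forall e, p e != 0 -> load C x e \is a Num.int) ->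
      \sum_(A in C) x A \isn't a Num.int ->
    [/\ forall A, 0 <= frac (x A), forall A, c A = 0 -> frac (x A) = 0,
      forall e, p e != 0 -> load C (fun A => frac (x A)) e \is a Num.int
      & \sum_(A in C) frac (x A) \isn't a Num.int].
    move=> x0 xZ xNZ; split=> [A|A /x0 ->|e pe|].
    - exact: frac_ge0.
    - exact: frac0.
    - rewrite -[load _ _ _](subKr (load C x e)) rpredB ?xZ //.
      by apply: load_sub_int => A; apply: frac_int.
    - by apply: sumZ xNZ => A; apply: frac_int.
  have c1P := fracP c (fun A cA => cA) cZ cNZ.
  have c2P := fracP (fun A => - c A).
  have {c2P} [|||c2_0 c2T c2Z c2NZ] := c2P.
  - by move=> A ->; rewrite oppr0.
  - by move=> e pe; rewrite /load sumrN rpredN cZ.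
  - by rewrite sumrN rpredN.
  have : \sum_(A in C) c1 A + \sum_(A in C) c2 A <= d.+1%:R.
    apply: (@le_trans _ _ #|supp C c|%:R); last by rewrite ler_nat.
    rewrite -big_split -sumr_const big_mkcond [leRHS]big_mkcond /=.
    apply: ler_sum => A _; rewrite inE; case: (A \in C) => //=.
    case: eqVneq => [cA|_]; last exact: frac_opp_le1.
    by rewrite /c1 /c2 cA oppr0 frac0 addr0.
  have [h12|h12] := leP (\sum_(A in C) c1 A) (\sum_(A in C) c2 A) => sum12.
    by case: c1P => *; exists c1; split => //; lra.
  by exists c2; split => //; lra.
have [w' [h [tw' tauw' npk hlt]]] := @roundup_not_packed _ C p c' d0 hC
  (conj p0 pA) c'0 (fun A => cT c' A (fun aA => c'T A (ac A aA))) c'load c'sum.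
exists w', h; split => //.
rewrite -ltnS -(ltr_nat rat) natrM -!natr1 ; move: c'half; rewrite -natr1; lra.
Qed.

(** * Fractional packings of large value *)

(** Cauchy-Schwarz against the constant vector, as nonnegativity of the
    variance. *)
Lemma sqr_sum_le (E : finType) (v : E -> rat) :
  (\sum_e v e) ^+ 2 <= #|E|%:R * \sum_e v e ^+ 2.
Proof.
have [E0|Egt0] := posnP #|E|.
  rewrite big1 ?expr0n ?E0 ?mul0r // => e _.
  by have := fintype0 e E0.
set X := \sum_e v e; set S := \sum_e _.
have Epos : 0 < #|E|%:R :> rat by rewrite ltr0n.
have : 0 <= \sum_e (v e - X / #|E|%:R) ^+ 2.
  by apply: sumr_ge0 => e _; exact: sqr_ge0.
under eq_bigr do rewrite sqrrB.
rewrite big_split sumrB /= -/S sumrMnl -mulr_suml -/X sumr_const -[X in _ + X]mulr_natr.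
have -> : S - X * (X / #|E|%:R) *+ 2 + (X / #|E|%:R) ^+ 2 * #|E|%:R
   = (#|E|%:R * S - X ^+ 2) / #|E|%:R.
  by field; rewrite gt_eqF.
by rewrite pmulr_lge0 ?invr_gt0 // subr_ge0.
Qed.

(** The double count. With [t = d + 1 - tau], [r = (d + 1) / t] and [S] the sum
    of [c A * #|Q A|], the excess condition gives [S >= tau * (1 + r)] by
    convexity of [x / (1 - x)]. On the other hand, the total weight [nu e] of the
    traces through [e] is at most [w e], so
    [S^2 / (2 d) <= sum_e (nu e)^2 <= sum_A c A * w (Q A) <= tau (tau - 2) + S]. *)
Lemma trace_count (d : nat) (E : finType) (X : {set {set E}}) (c : {set E} -> rat)
    (w : E -> rat) (Q : {set E} -> {set E}) (tau : rat) :
    #|E| = (2 * d)%N -> (#|X| <= d.+1)%N ->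
    (forall A, A \in X -> 0 <= c A) ->
    (forall A, A \in X -> Q A \subset A) ->
    (forall A, A \in X -> (0 < #|Q A|)%N) ->
    (forall A, A \in X -> 1 <= (1 - c A) * (#|Q A|%:R - 1)) ->
    (forall A, A \in X -> \sum_(e in Q A) w e <= tau + #|Q A|%:R - 2) ->
    (forall e, \sum_(A in X | e \in A) c A = w e) ->
    \sum_(A in X) c A = tau -> 2 <= tau -> tau < d.+1%:R ->
  (d.+1%:R : rat) ^+ 2 <= 2 * d%:R * (d.+1%:R - tau) ^+ 2.
Proof.
move=> cardE cardX c0 QA Q1 excess wQ wE sumc tau2 ltau.
rewrite leNgt; apply/negP => small.
set D : rat := d.+1%:R in ltau small; have DE : D = d%:R + 1 by rewrite /D -natr1.
have [t t0 tE] : exists2 t : rat, 0 < t & t = D - tau by exists (D - tau); lra.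
have d0 : 0 <= d%:R :> rat := ler0n _ d.
pose r : rat := D / t; have rt : r * t = D by rewrite /r divfK ?gt_eqF.
(* The tangent at [m = 1 / r] of the convex function [1 / m]: it replaces the
   convexity argument by a termwise bound that sums linearly. *)
have muP A : A \in X -> 2 * r - 1 - r ^+ 2 * (1 - c A) <= c A * (#|Q A|%:R - 1).
  move=> AX; have cA := c0 A AX; have := excess A AX.
  set m := 1 - c A; set a := #|Q A|%:R - 1 => am.
  have cE : c A = 1 - m by rewrite /m; ring.
  have q1 : 0 <= a by rewrite subr_ge0 ler1n Q1.
  have m0 : 0 < m.
    rewrite ltNge; apply/negP => m_le0.
    by have := mulr_le0_ge0 m_le0 q1; lra.
  rewrite -subr_ge0 -(pmulr_rge0 _ m0) cE.
  have := sqr_ge0 (1 - r * m).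
  have : (1 - m) * 1 <= (1 - m) * (m * a) by rewrite ler_wpM2l // -cE.
  by nra.
pose nu e := \sum_(A in X | e \in Q A) c A.
pose S := \sum_(A in X) c A * #|Q A|%:R.
have nuS : \sum_e nu e = S.
  rewrite /nu (exchange_big_dep (mem X)) /=; last by move=> e A _ /andP[].
  apply: eq_bigr => A AX; rewrite AX /=.
  by rewrite sumr_const mulr_natr.
have nuw e : nu e <= w e.
  rewrite -wE /nu [leRHS]big_mkcondr [leLHS]big_mkcondr /=.
  apply: ler_sum => A AX; have /subsetP/(_ e) := QA A AX.
  by case: (e \in Q A) => [->//|_]; case: ifP => // _; apply: c0.
have nu2 : \sum_e nu e ^+ 2 <= tau * (tau - 2) + S.
  have -> : tau * (tau - 2) + S = \sum_(A in X) c A * (tau + #|Q A|%:R - 2).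
    rewrite /S -{1}sumc mulr_suml -big_split /=.
    by apply: eq_bigr => A _; ring.
  apply: (@le_trans _ _ (\sum_e nu e * w e)).
    apply: ler_sum => e _; rewrite expr2 ler_wpM2l ?nuw //.
    by apply: sumr_ge0 => A /andP[/c0].
  apply: (@le_trans _ _ (\sum_(A in X) c A * \sum_(e in Q A) w e)); last first.
    by apply: ler_sum => A AX; rewrite ler_wpM2l ?c0 ?wQ.
  under eq_bigr do rewrite /nu mulr_suml.
  rewrite (exchange_big_dep (mem X)) /=; last by move=> e A _ /andP[].
  apply: ler_sum => A AX; rewrite mulr_sumr.
  by under eq_bigl do rewrite AX.
have lowS : tau * (1 + r) <= S.
  have -> : S = tau + \sum_(A in X) c A * (#|Q A|%:R - 1).
    by rewrite -[in RHS]sumc -big_split /=; apply: eq_bigr => A _; ring.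
  have : \sum_(A in X) (2 * r - 1 - r ^+ 2 * (1 - c A))
      <= \sum_(A in X) c A * (#|Q A|%:R - 1) by apply: ler_sum.
  have -> : \sum_(A in X) (2 * r - 1 - r ^+ 2 * (1 - c A))
      = r ^+ 2 * tau - (r - 1) ^+ 2 * #|X|%:R.
    rewrite -sumc mulr_sumr mulr_natr -sumr_const -sumrB.
    by apply: eq_bigr => A _; ring.
  have kD : #|X|%:R <= D by rewrite ler_nat.
  have := ler_wpM2l (sqr_ge0 (r - 1)) kD.
  have tauE : tau = D - t by lra.
  have -> : (r - 1) ^+ 2 * D = (r - 1) * tau * r by rewrite tauE -rt; ring.
  by nra.
have := sqr_sum_le nu; rewrite nuS cardE natrM => cs.
have {}cs : S ^+ 2 <= 2 * d%:R * (tau * (tau - 2) + S).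
  by apply: le_trans cs _; rewrite ler_wpM2l // mulr_ge0.
have tauE : tau = D - t by lra.
(* [S * t >= Y0] and [upY] are multiplied by powers of [t] to avoid [r]; the
   value of the quadratic [y (y - 2 d t)] at [Y0] already exceeds [K]. *)
set Y0 := tau * (t + D); set K := 2 * d%:R * (tau * (tau - 2)) * t ^+ 2.
have Y0_le : Y0 <= S * t.
  apply: (@le_trans _ _ (tau * (1 + r) * t)); last by rewrite ler_pM2r.
  by rewrite /Y0 -mulrA mulrDl mul1r rt.
have upY : S * t * (S * t - 2 * d%:R * t) <= K.
  have := ler_wpM2r (sqr_ge0 t) cs; rewrite /K; lra.
have K0 : 0 <= K.
  by rewrite /K !mulr_ge0 ?sqr_ge0 ?subr_ge0 //; lra.
have lowY : K < Y0 * (Y0 - 2 * d%:R * t).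
  have -> : Y0 * (Y0 - 2 * d%:R * t)
     = K + tau * (D - t) * ((t + D) ^+ 2 - 2 * d%:R * t * (1 + t)).
    by rewrite /Y0 /K tauE DE; ring.
  rewrite ltrDl -tauE !mulr_gt0 //; try lra.
  have : 2 * d%:R * t ^+ 2 < D ^+ 2 by rewrite tE.
  by have := mulr_gt0 t0 t0; rewrite DE; lra.
have Y0pos : 0 < Y0 by rewrite /Y0 mulr_gt0 // ?addr_gt0 //; lra.
have Y0big : 0 < Y0 - 2 * d%:R * t.
  by rewrite -(pmulr_rgt0 _ Y0pos); apply: le_lt_trans lowY.
have : Y0 * (Y0 - 2 * d%:R * t) <= S * t * (S * t - 2 * d%:R * t).
  by apply: ler_pM => //; [exact: ltW | exact: ltW | rewrite lerD2r].
lra.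
Qed.

(** If no member [A] of the support works, the failures provide covers [B A]
    whose traces [A :&: B A] satisfy the hypotheses of [trace_count]. *)
Lemma large_tau_step d (C : {set {set ground d}}) (w : ground d -> nat) c :
    (0 < d)%N -> cuboid C -> (forall A, 0 <= c A) ->
    (forall e, load C c e = (w e)%:R) -> \sum_(A in C) c A = (tau C w)%:R ->
    (#|supp C c| <= d.+1)%N -> (2 <= tau C w)%N ->
    (2 * d * (d.+1 - tau C w) ^ 2 < d.+1 ^ 2)%N ->
  exists A, [/\ A \in C, forall e, e \in A -> (0 < w e)%N
    & ((tau C w).-1 <= tau C (fun e => w e - (e \in A))%N)%N].
Proof.
move=> d0 hC c0 loadE sumc suppD tau2 small; have C0 := cuboid_set0 d0 hC.
apply: contrapT => /forallNP noA.
have XC A : A \in supp C c -> A \in C by rewrite inE => /andP[].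
have cpos A : A \in supp C c -> 0 < c A.
  by rewrite inE => /andP[_ cA]; rewrite lt_neqAle eq_sym cA c0.
have wA A : A \in supp C c -> forall e, e \in A -> (0 < w e)%N.
  move=> AX e eA; rewrite -(ltr0n rat) -loadE /load (bigD1 A) /= ?XC ?eA //.
  by rewrite ltr_pwDl ?cpos // sumr_ge0.
have /fin_all_exists[B BP] A : exists B : {set ground d}, A \in supp C c ->
    is_cover C B /\ (weight w B + 2 <= tau C w + #|A :&: B|)%N.
  have [AX|] := boolP (A \in supp C c); last by exists set0.
  have [[B cB wB] _] := tauP (fun e => w e - (e \in A))%N C0.
  have := noA A; exists B => _; split=> //.
  rewrite -(weight_sub B (wA A AX)) wB.
  case: leqP => // gt; case: (noA A); split; [exact: XC | exact: wA | ].
  by move: gt; lia.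
pose Q A := A :&: B A.
have weightR A : (weight w (B A))%:R = \sum_(A' in C) c A' * #|A' :&: B A|%:R :> rat.
  by rewrite -sum_load /weight natr_sum; apply: eq_bigr => e _.
have Q1 A : A \in supp C c -> (0 < #|Q A|)%N.
  move=> AX; have [/forall_inP cB _] := BP A AX.
  by rewrite card_gt0 cB ?XC.
have excess A : A \in supp C c -> 1 <= (1 - c A) * (#|Q A|%:R - 1).
  move=> AX; have [/forall_inP cB] := BP A AX.
  rewrite -(ler_nat rat) !natrD weightR -/(Q A).
  have := sumc; rewrite (bigD1 A) ?XC //= => <-; rewrite (bigD1 A) ?XC //= -/(Q A).
  have : \sum_(A' in C | A' != A) c A'
      <= \sum_(A' in C | A' != A) c A' * #|A' :&: B A|%:R.
    apply: ler_sum => A' /andP[A'C _]; rewrite ler_peMr //.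
    by rewrite ler1n card_gt0 cB.
  by lra.
have sumX : \sum_(A in supp C c) c A = (tau C w)%:R.
  rewrite -sumc; have := sum_supp C c predT.
  by under eq_bigl do rewrite andbT; under [X in _ = X]eq_bigl do rewrite andbT.
have wX e : \sum_(A in supp C c | e \in A) c A = (w e)%:R.
  by rewrite sum_supp -/(load C c e).
have ltau : ((tau C w)%:R : rat) < d.+1%:R.
  have [A0 A0X] : exists A, A \in supp C c.
    apply/set0Pn; apply: contraTneq tau2 => X0.
    by rewrite -(ler_nat rat) -sumX X0 big_set0.
  have mu_pos A : A \in supp C c -> 0 < 1 - c A.
    move=> AX; rewrite ltNge; apply/negP => mu_le0; have := excess A AX.
    have : 0 <= #|Q A|%:R - 1 :> rat by rewrite subr_ge0 ler1n Q1.
    by move=> q0; have := mulr_le0_ge0 mu_le0 q0; lra.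
  have : 0 < \sum_(A in supp C c) (1 - c A).
    by rewrite (bigD1 A0) //= ltr_pwDl ?mu_pos // sumr_ge0 // => A /andP[/mu_pos/ltW].
  rewrite sumrB sumr_const sumX subr_gt0 => lt1; apply: lt_le_trans lt1 _.
  by rewrite ler_nat.
have cardE : #|ground d| = (2 * d)%N by rewrite card_prod card_ord card_bool mulnC.
have wQ A : A \in supp C c ->
    \sum_(e in Q A) (w e)%:R <= (tau C w)%:R + #|Q A|%:R - 2 :> rat.
  move=> AX; have [_] := BP A AX; rewrite -(ler_nat rat) !natrD -/(Q A).
  suff : \sum_(e in Q A) (w e)%:R <= (weight w (B A))%:R :> rat by lra.
  rewrite -natr_sum ler_nat /weight [leqRHS](big_setID A) /= setIC.
  exact: leq_addr.
have := trace_count cardE suppD (fun A _ => c0 A) (fun A _ => subsetIl A (B A))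
  Q1 excess wQ wX sumX; rewrite (ler_nat rat 2) => /(_ tau2 ltau).
apply/negP; rewrite -ltNge -natrB; last by rewrite ltnW // -(ltr_nat rat).
by rewrite -!natrX -!natrM ltr_nat.
Qed.

(** * The bound on tau *)

Lemma le_tau_bound (R : realType) d h : (0 < d)%N -> (2 * h <= d.+2)%N ->
  h%:Z <= tau_bound R d.
Proof.
move=> d0 h2; rewrite /tau_bound le_max floor_ge_int ler_pdivlMr ?ltr0n //.
by rewrite natr1 -pmulrn -!natrM ler_nat; apply/orP; left; lia.
Qed.

(** The second term of the maximum gives the quadratic inequality, the first one
    gives [2 <= h]. The truncated difference is harmless: it is 0 when
    [h > d]. *)
Lemma tau_bound_lt (R : realType) d h : (0 < d)%N -> tau_bound R d < h%:Z ->
  (2 <= h)%N /\ (2 * d * (d.+1 - h) ^ 2 < d.+1 ^ 2)%N.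
Proof.
move=> d0 lt_h; split.
  have := @le_tau_bound R d 1 d0 isT => le1; rewrite -ltz_nat; exact: le_lt_trans lt_h.
have [hd|] := leqP d.+1 h.
  have /eqP-> : (d.+1 - h == 0)%N by rewrite subn_eq0.
  by rewrite muln0 expn_gt0.
move=> /ltnW hd; move: lt_h.
rewrite /tau_bound gt_max => /andP[_]; rewrite floor_lt_int -pmulrn natr1.
set s := Num.sqrt _.
have s2 : s ^+ 2 = 2 * d%:R by rewrite sqr_sqrtr ?mulr_ge0 ?ler0n.
have s0 : 0 < s by rewrite sqrtr_gt0 -natrM ltr0n; lia.
rewrite -(ltr_nat R) natrM !natrX natrB // natrM -s2 -exprMn => lt_h.
rewrite ltr_pXn2r ?nnegrE ?mulr_ge0 ?subr_ge0 ?ler_nat ?ltW //.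
have DE : d.+1%:R = s * (1 / s * d.+1%:R) :> R by field; rewrite gt_eqF.
rewrite [ltRHS]DE ltr_pM2l // ltrBlDl -ltrBlDr.
by move: lt_h; rewrite mulrBl !mul1r.
Qed.

(** The induction on [tau], for any bound that is at least [(d + 2) / 2] and
    beyond which [large_tau_step] applies. The first property rules out
    fractional covers lighter than [tau], through [nonideal_witness]. *)
Lemma tight_packed d (C : {set {set ground d}}) :
    (0 < d)%N -> cuboid C ->
    (forall w h, tight w h -> tau C w = h -> (2 * h <= d.+2)%N -> packed C w h) ->
    (forall w h, tight w h -> tau C w = h ->
       packed C w h \/ (2 <= h)%N /\ (2 * d * (d.+1 - h) ^ 2 < d.+1 ^ 2)%N) ->
  forall h w, tight w h -> tau C w = h -> packed C w h.
Proof.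
move=> d0 hC small large; elim=> [|h IHh] w tw tauw; first exact: small.
have [//|[h2 h_large]] := large w h.+1 tw tauw.
have [[c [c0 c_load c_sum]]|[p covp ltp]] := packing_or_cover C w h.+1; last first.
  rewrite -tauw in ltp.
  have [w' [h' [tw' tauw' npk h'2]]] := nonideal_witness d0 hC covp ltp.
  by case: npk; apply: small.
(* On each pair both capacities and loads add up to [tau], so no slack is left. *)
have {}c_load e : load C c e = (w e)%:R.
  apply/eqP; rewrite eq_le c_load /=.
  have := c_load (mate e); rewrite load_mate // c_sum -(tw e) natrD; lra.
have [c' [c'0 _ c'l c's c'supp]] := caratheodory hC c0.
have c'w e : load C c' e = (w e)%:R by rewrite c'l.
have c'tau : \sum_(A in C) c' A = (tau C w)%:R by rewrite c's tauw.
rewrite -tauw in h2 h_large.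
have [A [inC wA le_tau]] := large_tau_step d0 hC c'0 c'w c'tau c'supp h2 h_large.
rewrite tauw /= in le_tau.
have [w' [w'w tw' tauw']] := tight_reduction d0 hC le_tau.
by apply: (packedS inC wA); apply: (packed_le w'w); apply: IHh.
Qed.

Theorem theorem3 (R : realType) (d : nat) (hd : (1 <= d)%N)
    (C : {set {set ground d}}) (hC : cuboid C) :
  MFMC C <->
  forall w : ground d -> nat,
    (forall i : 'I_d, (w (elt i) + w (bar i))%N = tau C w) ->
    ((tau C w)%:Z <= tau_bound R d)%R ->
    tau C w = nu C w.
Proof.
have C0 := cuboid_set0 hd hC.
split=> [mfmc w _ _|bounded]; first exact: mfmc.
have low w h : tight w h -> tau C w = h -> h%:Z <= tau_bound R d -> packed C w h.
  move=> tw tauw le_h; rewrite -tauw; apply/(tau_eq_nuP w C0)/bounded.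
    by move=> i; rewrite tauw -(tw (elt i)).
  by rewrite tauw.
move=> w; apply/(tau_eq_nuP w C0).
have [w' [w'w tw' tauw']] := tight_reduction hd hC (leqnn (tau C w)).
apply: packed_le w'w _; apply: (tight_packed hd hC) tw' tauw'.
  by move=> {}w h tw tauw h2; apply: low => //; apply: le_tau_bound.
move=> {}w h tw tauw; have [/low|/tau_bound_lt] := leP h%:Z (tau_bound R d).
  by left; auto.
by right; auto.
Qed.
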